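(* Let $H$ be an infinite-dimensional complex Hilbert space and let $\mathcal{G}_{\infty}(H)$ be the set of all closed subspaces of $H$ whose dimension and codimension are both infinite. Let $f:\mathcal{G}_{\infty}(H)\to\mathcal{G}_{\infty}(H)$ be a (not necessarily surjective) map sending every pair of subspaces to an equivalent pair of subspaces, i.e. for all $X,Y\in\mathcal{G}_{\infty}(H)$ there is a linear isometry $L_{\{X,Y\}}:H\to H$ with $\{f(X),f(Y)\}=\{L_{\{X,Y\}}(X),L_{\{X,Y\}}(Y)\}$. Then there is a linear or conjugate linear isometry $L:H\to H$, unique up to a scalar multiple, and for every $X\in\mathcal{G}_{\infty}(H)$ a closed subspace $O(X)$ orthogonal to the range of $L$, such that $$f(X)=L(X)\oplus O(X)\quad\text{for all }X\in\mathcal{G}_{\infty}(H).$$ Moreover, if $X,Y$ belong to the same component of $\mathcal{G}_{\infty}(H)$, then $O(X)=O(Y)$; and if $X,Y\in\mathcal{G}_{\infty}(H)$ with $Y\subset X$, then $O(Y)\subset O(X)$.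
   Context: A linear isometry $H\to H$ is a norm-preserving linear map (not necessarily surjective); a conjugate linear isometry is a norm-preserving conjugate linear map. Two pairs of closed subspaces are equivalent if some linear isometry of $H$ transfers one pair (as an unordered pair) to the other. A component of $\mathcal{G}_{\infty}(H)$ is a subset $\mathcal{C}$ maximal with respect to the property that $\operatorname{codim}_X(X\cap Y)<\infty$ and $\operatorname{codim}_Y(X\cap Y)<\infty$ for all $X,Y\in\mathcal{C}$; the component containing $X$ consists of all $Y\in\mathcal{G}_{\infty}(H)$ satisfying these two finiteness conditions with $X$. *)

(* Defs.v *)
From HB Require Import structures.
From mathcomp Require Import all_boot all_order all_algebra.
From mathcomp Require Import complex.
From mathcomp Require Import boolp classical_sets reals.

Set Implicit Arguments.
Unset Strict Implicit.
Unset Printing Implicit Defensive.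

Import Order.TTheory GRing.Theory Num.Theory.
Local Open Scope ring_scope.
Local Open Scope classical_set_scope.

Section Hilbert.
Variables (R : realType) (H : lmodType R[i]) (ip : H -> H -> R[i]).

Record inner_product : Prop := InnerProduct {
  ip_linl : forall (a : R[i]) x y z, ip (a *: x + y) z = a * ip x z + ip y z;
  ip_conjsym : forall x y, ip y x = (ip x y)^*;
  ip_ge0 : forall x, 0 <= ip x x;
  ip_def : forall x, ip x x = 0 -> x = 0 }.

(* induced norm ||x|| = sqrt <x,x> (a nonnegative real, viewed in R[i]) *)
Definition hnorm (x : H) : R[i] := sqrtC (ip x x).

Definition cauchy_seq (u : nat -> H) : Prop :=
  forall e : R[i], 0 < e -> exists N, forall m n, (N <= m)%N -> (N <= n)%N ->
    hnorm (u m - u n) < e.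

Definition seq_cvg_to (u : nat -> H) (l : H) : Prop :=
  forall e : R[i], 0 < e -> exists N, forall n, (N <= n)%N -> hnorm (u n - l) < e.

Definition hcomplete : Prop :=
  forall u, cauchy_seq u -> exists l, seq_cvg_to u l.

Definition hilbert_space : Prop := inner_product /\ hcomplete.

Definition finspan (s : seq H) : set H :=
  [set x | exists c : nat -> R[i], x = \sum_(i < size s) c i *: s`_i].

Definition setsum (A B : set H) : set H :=
  [set z | exists a b, A a /\ B b /\ z = a + b].

Definition subspace (X : set H) : Prop :=
  X 0 /\ forall (a : R[i]) x y, X x -> X y -> X (a *: x + y).

Definition closed_set (X : set H) : Prop :=
  forall u l, (forall n, X (u n)) -> seq_cvg_to u l -> X l.

Definition closed_subspace (X : set H) : Prop := subspace X /\ closed_set X.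

Definition fin_codim (X Z : set H) : Prop := exists s : seq H, X = setsum Z (finspan s).

Definition inf_dim (X : set H) : Prop := ~ exists s : seq H, X = finspan s.
Definition inf_codim (X : set H) : Prop := ~ fin_codim setT X.

Definition Ginf (X : set H) : Prop := closed_subspace X /\ inf_dim X /\ inf_codim X.

Definition same_component (X Y : set H) : Prop :=
  fin_codim X (X `&` Y) /\ fin_codim Y (X `&` Y).

Definition linear_map (L : H -> H) : Prop :=
  forall (a : R[i]) x y, L (a *: x + y) = a *: L x + L y.
Definition conj_linear_map (L : H -> H) : Prop :=
  forall (a : R[i]) x y, L (a *: x + y) = a^* *: L x + L y.
Definition norm_preserving (L : H -> H) : Prop := forall x, hnorm (L x) = hnorm x.

Definition linear_isometry (L : H -> H) : Prop := linear_map L /\ norm_preserving L.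
Definition conj_linear_isometry (L : H -> H) : Prop :=
  conj_linear_map L /\ norm_preserving L.

Definition equivalent_pairs (X Y X' Y' : set H) : Prop :=
  exists L, linear_isometry L /\
    ((X' = L @` X /\ Y' = L @` Y) \/ (X' = L @` Y /\ Y' = L @` X)).

Definition orth_to_range (O : set H) (L : H -> H) : Prop :=
  forall o x, O o -> ip o (L x) = 0.

Definition decomposes (f : set H -> set H) (L : H -> H) (O : set H -> set H) : Prop :=
  forall X, Ginf X ->
    closed_subspace (O X) /\ orth_to_range (O X) L /\ f X = setsum (L @` X) (O X).

End Hilbert.

(* Main.v *)
Require Import Defs.
From HB Require Import structures.
From mathcomp Require Import all_boot all_order all_algebra.
From mathcomp Require Import complex.
From mathcomp Require Import boolp classical_sets reals.
From mathcomp Require Import zify ring.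
Import Order.TTheory GRing.Theory Num.Theory.
Local Open Scope ring_scope.
Local Open Scope classical_set_scope.

(* The relations "X = Y", "X is orthogonal to Y" and "the projections onto X and
   Y commute" are symmetric, so f preserves them although the pairs are
   unordered.  Testing inclusion against orthogonal complements shows that f
   also preserves the order.  If the line P is orthogonal to X, the pair
   (X, X + P) shows that f(X + P) = f(X) + P' for a line P' orthogonal to f(X).
   Commutation applied to (X + P, Y) for X inside Y orthogonal to P shows that P'
   does not change when X is replaced by Y; any two elements of Ginf orthogonal
   to P are linked by such inclusions, through the closed spans of parts of an
   orthogonal sequence.  The pairs (X + P, X + Q) show that P -> P' preserves
   angles, so by Wigner's theorem (proved following Bargmann) it is induced by a
   linear or conjugate linear isometry L.  Then L(X) lies in f(X), L maps the
   complement of X into that of f(X), and O(X) is the intersection of f(X) with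
   the complement of the range of L. *)

Set Implicit Arguments.
Unset Strict Implicit.

(** * Inner product identities, the Cauchy-Schwarz inequality and polarization *)

Section InnerProduct.
Variables (R : realType) (H : lmodType R[i]) (ip : H -> H -> R[i]).
Hypothesis ipP : inner_product ip.
Local Notation "''[' x , y ]" := (ip x y) (format "''[' x ,  y ]").

Lemma ipDl x y z : '[x + y, z] = '[x, z] + '[y, z].
Proof. by have := ip_linl ipP 1 x y z; rewrite scale1r mul1r. Qed.

Lemma ip0l z : '[0, z] = 0.
Proof. by apply: (addrI '[0, z]); rewrite -ipDl !addr0. Qed.

Lemma ipZl a x z : '[a *: x, z] = a * '[x, z].
Proof. by have := ip_linl ipP a x 0 z; rewrite addr0 ip0l addr0. Qed.

Lemma ipNl x z : '[- x, z] = - '[x, z].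
Proof. by rewrite -scaleN1r ipZl mulN1r. Qed.

Lemma ipBl x y z : '[x - y, z] = '[x, z] - '[y, z].
Proof. by rewrite ipDl ipNl. Qed.

Lemma ip_conj x y : '[x, y]^* = '[y, x].
Proof. by rewrite [RHS](ip_conjsym ipP). Qed.

Lemma ipDr x y z : '[z, x + y] = '[z, x] + '[z, y].
Proof. by rewrite -ip_conj ipDl rmorphD /= !ip_conj. Qed.

Lemma ip0r z : '[z, 0] = 0.
Proof. by rewrite -ip_conj ip0l rmorph0. Qed.

Lemma ipZr a x z : '[z, a *: x] = a^* * '[z, x].
Proof. by rewrite -ip_conj ipZl rmorphM /= ip_conj. Qed.

Lemma ipNr x z : '[z, - x] = - '[z, x].
Proof. by rewrite -ip_conj ipNl rmorphN /= ip_conj. Qed.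

Definition ipE := (ipDl, ipDr, ipZl, ipZr, ipNl, ipNr, ip0l, ip0r).

Lemma ip_orthC x y : '[x, y] = 0 -> '[y, x] = 0.
Proof. by move=> h; rewrite -ip_conj h rmorph0. Qed.

Lemma ipxx_eq0 x : ('[x, x] == 0) = (x == 0).
Proof.
by apply/eqP/eqP => [/(ip_def ipP)//|->]; rewrite ip0l.
Qed.

Lemma ipxx_conj x : '[x, x]^* = '[x, x]. Proof. exact: ip_conj. Qed.

Lemma ip_normC x y : `|'[x, y]| = `|'[y, x]|.
Proof. by rewrite -ip_conj norm_conjC. Qed.

(* Equal to [0] when [v = 0]. *)
Definition proj_coef (x v : H) : R[i] := '[x, v] / '[v, v].

Lemma proj_coef_orth x v : '[x - proj_coef x v *: v, v] = 0.
Proof.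
have [->|v0] := eqVneq v 0; first by rewrite ip0r.
by rewrite !ipE /proj_coef divfK ?subrr// ipxx_eq0.
Qed.

Lemma ipxx_proj_coef x v : '[x, x] =
  '[x - proj_coef x v *: v, x - proj_coef x v *: v] + `|proj_coef x v| ^+ 2 * '[v, v].
Proof.
have h := proj_coef_orth x v; have h' := ip_orthC h.
rewrite -{1 2}(subrK (proj_coef x v *: v) x).
move: (proj_coef x v) (x - _) h h' => c z h h'.
by rewrite !ipE h h' normCK; ring.
Qed.

(** Kept free of division so that it also covers [v = 0]. *)
Lemma proj_coef_norm x v : `|proj_coef x v| ^+ 2 * '[v, v] * '[v, v] = `|'[x, v]| ^+ 2.
Proof.
have [->|v0] := eqVneq v 0; first by rewrite !ip0r !mulr0 normr0 expr0n.
have v1 : '[v, v] != 0 by rewrite ipxx_eq0.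
rewrite /proj_coef normf_div (ger0_norm (ip_ge0 ipP v)); by field.
Qed.

(** By Pythagoras the projection of [x] onto the line of [y] is no longer than [x]. *)
Lemma cauchy_schwarz x y : `|'[x, y]| ^+ 2 <= '[x, x] * '[y, y].
Proof.
rewrite -proj_coef_norm; apply: ler_wpM2r; first exact: ip_ge0 ipP _.
by rewrite [leRHS](ipxx_proj_coef x y) lerDr (ip_ge0 ipP).
Qed.

(** Equality makes the orthogonal part in Pythagoras vanish. *)
Lemma cauchy_schwarz_eq x y : y != 0 -> `|'[x, y]| ^+ 2 = '[x, x] * '[y, y] ->
  x = proj_coef x y *: y.
Proof.
move=> y0; rewrite -proj_coef_norm => /(mulIf _); rewrite ipxx_eq0 => /(_ y0).
rewrite [RHS](ipxx_proj_coef x y) => /esym/eqP; rewrite -subr_eq0 addrK ipxx_eq0 subr_eq0.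
by move/eqP.
Qed.

Lemma parallelogram x y :
  '[x + y, x + y] + '[x - y, x - y] = 2 * ('[x, x] + '[y, y]).
Proof. rewrite !ipE; ring. Qed.

Lemma hnorm_sqr x : hnorm ip x ^+ 2 = '[x, x].
Proof. by rewrite /hnorm sqrtCK. Qed.

Lemma hnorm_ltE x e : 0 < e -> (hnorm ip x < e) = ('[x, x] < e ^+ 2).
Proof.
move=> e0; rewrite -hnorm_sqr ltr_pXn2r// nnegrE; last exact: ltW.
by rewrite sqrtC_ge0 (ip_ge0 ipP).
Qed.

Lemma norm_preservingE (L : H -> H) x : norm_preserving ip L -> '[L x, L x] = '[x, x].
Proof. by move=> hL; rewrite -!hnorm_sqr hL. Qed.

Lemma lin_add (L : H -> H) : linear_map L -> forall x y, L (x + y) = L x + L y.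
Proof. by move=> hL x y; rewrite -[x]scale1r hL !scale1r. Qed.

Lemma conj_lin_add (L : H -> H) : conj_linear_map L -> forall x y, L (x + y) = L x + L y.
Proof. by move=> hL x y; rewrite -[x]scale1r hL rmorph1 !scale1r. Qed.

Lemma lin0 (L : H -> H) : linear_map L -> L 0 = 0.
Proof. by move=> hL; apply: (addrI (L 0)); rewrite -lin_add ?addr0. Qed.

Lemma conj_lin0 (L : H -> H) : conj_linear_map L -> L 0 = 0.
Proof. by move=> hL; apply: (addrI (L 0)); rewrite -conj_lin_add ?addr0. Qed.

Lemma lin_scale (L : H -> H) : linear_map L -> forall a x, L (a *: x) = a *: L x.
Proof. by move=> hL a x; have := hL a x 0; rewrite (lin0 hL) !addr0. Qed.

Lemma conj_lin_scale (L : H -> H) : conj_linear_map L ->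
  forall a x, L (a *: x) = a^* *: L x.
Proof. by move=> hL a x; have := hL a x 0; rewrite (conj_lin0 hL) !addr0. Qed.

(** Expanding the norm of [L (x + y)] needs additivity only, so linear and conjugate linear maps are
    treated together. *)
Lemma additive_isometry_re (L : H -> H) : (forall x y, L (x + y) = L x + L y) ->
  norm_preserving ip L ->
  forall x y, '[L x, L y] + '[L y, L x] = '[x, y] + '[y, x].
Proof.
move=> La Ln x y; have := norm_preservingE (x + y) Ln.
rewrite La !ipE !norm_preservingE//.
move=> /(congr1 (fun z => z - '[x, x] - '[y, y])).
set a := '[L x, L y]; set b := '[L y, L x] => h.
transitivity ('[x, x] + a + (b + '[y, y]) - '[x, x] - '[y, y]); first by ring.
by rewrite h; ring.
Qed.

(** Polarization: the real part is preserved for [y] and for ['i *: y], and the second case gives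
    the imaginary part. *)
Lemma lin_isometry_ip (L : H -> H) : linear_isometry ip L ->
  forall x y, '[L x, L y] = '[x, y].
Proof.
move=> [Ll Ln] x y.
have h1 := additive_isometry_re (lin_add Ll) Ln x y.
have := additive_isometry_re (lin_add Ll) Ln x ('i *: y).
rewrite (lin_scale Ll) !ipE conjCi => h2.
apply: (mulfI (x := 2 * 'i)); first by rewrite mulf_neq0 ?neq0Ci ?pnatr_eq0.
transitivity ('i * ('[L x, L y] + '[L y, L x]) - (- 'i * '[L x, L y] + 'i * '[L y, L x])).
  by ring.
by rewrite h1 h2; ring.
Qed.

Lemma conj_lin_isometry_ip (L : H -> H) : conj_linear_isometry ip L ->
  forall x y, '[L x, L y] = '[y, x].
Proof.
move=> [Ll Ln] x y.
have h1 := additive_isometry_re (conj_lin_add Ll) Ln x y.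
have := additive_isometry_re (conj_lin_add Ll) Ln x ('i *: y).
rewrite (conj_lin_scale Ll) !ipE conjCi rmorphN /= conjCi opprK => h2.
apply: (mulfI (x := 2 * 'i)); first by rewrite mulf_neq0 ?neq0Ci ?pnatr_eq0.
transitivity ('i * ('[L x, L y] + '[L y, L x]) + ('i * '[L x, L y] + - 'i * '[L y, L x])).
  by ring.
by rewrite h1 h2; ring.
Qed.

(** * Completeness and orthogonal projections *)

Hypothesis completeH : hcomplete ip.

Lemma ge0_small (z K : R[i]) : 0 <= z -> 0 <= K ->
  (forall e, 0 < e -> z <= e * K) -> z = 0.
Proof.
move=> z0 K0 h; apply/eqP/negP => /negP zN0.
have zp : 0 < z by rewrite lt_def zN0.
(* The bound is tested at [z / (K + 1)] rather than [z / K] because [K] may be zero. *)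
have K1 : 0 < K + 1 by rewrite ltr_wpDl.
have := h (z / (K + 1)) (divr_gt0 zp K1).
rewrite -mulrA -{1}[z]mulr1 ler_pM2l// mulrC ler_pdivlMr// mul1r gerDl.
by rewrite ler10.
Qed.

Lemma normD_sqr_le (p q : R[i]) : `|p + q| ^+ 2 <= 2 * (`|p| ^+ 2 + `|q| ^+ 2).
Proof.
have -> : 2 * (`|p| ^+ 2 + `|q| ^+ 2) = `|p + q| ^+ 2 + `|p - q| ^+ 2.
  by rewrite !normCK rmorphD rmorphB /=; ring.
by rewrite lerDl exprn_ge0.
Qed.

Lemma seq_cvg_sqr u l : seq_cvg_to ip u l -> forall e, 0 < e ->
  exists N, forall n, (N <= n)%N -> '[u n - l, u n - l] < e.
Proof.
move=> h e e0; have e1 : 0 < sqrtC e by rewrite sqrtC_gt0.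
have [N hN] := h _ e1; exists N => n /hN.
by rewrite hnorm_ltE// sqrtCK.
Qed.

Lemma cvg_ip_eq0 u l y : seq_cvg_to ip u l -> (forall n, '[u n, y] = 0) ->
  '[l, y] = 0.
Proof.
move=> /seq_cvg_sqr ul uy; apply/eqP; rewrite -normr_eq0 -sqrf_eq0; apply/eqP.
apply: (@ge0_small _ '[y, y]); [exact: exprn_ge0 | exact: ip_ge0 |].
move=> e /ul[N /(_ N (leqnn N)) hN].
have -> : '[l, y] = - '[u N - l, y] by rewrite ipBl uy sub0r opprK.
rewrite normrN (le_trans (cauchy_schwarz _ _))//.
by apply: ler_wpM2r; [exact: ip_ge0 | exact: ltW].
Qed.

Lemma cvg_unique u l l' : seq_cvg_to ip u l -> seq_cvg_to ip u l' -> l = l'.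
Proof.
move=> /seq_cvg_sqr ul /seq_cvg_sqr ul'; apply/eqP; rewrite -subr_eq0 -ipxx_eq0.
apply/eqP; apply: (@ge0_small _ 4); [exact: ip_ge0 | by [] |].
move=> e e0; have [N hN] := ul e e0; have [M hM] := ul' e e0.
have := hN _ (leq_maxl N M); have := hM _ (leq_maxr N M).
set k := maxn N M => h1 h2.
have -> : l - l' = (u k - l') - (u k - l) by rewrite opprB [RHS]addrC addrA subrK.
have := parallelogram (u k - l') (u k - l).
move/(canRL (addKr _)) => ->.
have -> : e * 4 = 2 * (e + e) by ring.
rewrite addrC lerBlDr (@le_trans _ _ (2 * (e + e)))//; last first.
  by rewrite lerDl (ip_ge0 ipP).
by rewrite ler_wpM2l// lerD// ltW.
Qed.

Lemma natV_small (e : R[i]) : 0 < e -> exists N, N.+1%:R^-1 < e.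
Proof.
move=> e0; have er : (complex.Re e)%:C%C = e by apply: RRe_real; exact: gtr0_real.
have re0 : 0 < complex.Re e by rewrite -ltcR er.
exists (Num.bound (complex.Re e)^-1); set N := Num.bound _.
rewrite -er.
have -> : (N.+1%:R^-1 : R[i]) = ((N.+1%:R^-1 : R)%:C)%C.
  by rewrite (rmorphV (real_complex R)) ?unitfE ?pnatr_eq0//= (rmorph_nat (real_complex R)).
rewrite ltcR invf_plt ?posrE//.
have := @archi_boundP _ (complex.Re e)^-1; rewrite invr_ge0 ltW// => /(_ isT) h.
by apply: (lt_trans h); rewrite ltr_nat.
Qed.

Lemma natV_le (m n : nat) : (m <= n)%N -> n.+1%:R^-1 <= m.+1%:R^-1 :> R[i].
Proof. by move=> mn; rewrite lef_pV2 ?posrE ?ltr0Sn// ler_nat ltnS. Qed.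

(** The infimum is taken over real parts because the order of [R[i]] is only partial; squared
    distances are real, so nothing is lost. *)
Lemma dist_inf (X : set H) v : X 0 -> exists2 d : R[i],
  forall x, X x -> d <= '[v - x, v - x] &
  forall e, 0 < e -> exists2 x, X x & '[v - x, v - x] < d + e.
Proof.
move=> X0; pose E := [set r : R | exists2 x, X x & r = complex.Re '[v - x, v - x]].
have ReC x : (complex.Re '[x, x])%:C%C = '[x, x].
  by apply: RRe_real; apply: ger0_real; exact: ip_ge0.
have lbE : lbound E 0 by move=> _ [x _ ->]; rewrite -lecR ReC; exact: ip_ge0.
have infE : has_inf E.
  by split; [exists (complex.Re '[v - 0, v - 0]), 0 | exists 0].
exists (inf E)%:C%C => [x Xx|e e0].
  rewrite -ReC lecR; apply: ge_inf; first by exists 0.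
  by exists x.
have er : (complex.Re e)%:C%C = e by apply: RRe_real; exact: gtr0_real.
have re0 : 0 < complex.Re e by rewrite -ltcR er.
have [_ [x Xx ->] hx] := inf_adherent re0 infE.
by exists x => //; rewrite -ReC -er -(rmorphD (real_complex R)) /= ltcR.
Qed.

Definition orth (A : set H) : set H := [set x | forall y, A y -> '[x, y] = 0].

(** A minimizing sequence for the distance from [v] to [X] is Cauchy by the parallelogram law, and
    its limit is the foot of the perpendicular. *)
Lemma projection (X : set H) v : closed_subspace ip X ->
  exists2 x, X x & orth X (v - x).
Proof.
move=> [[X0 Xlin] Xcl].
have [d dle dlt] := dist_inf v X0.
have /choice[u hu] : forall n : nat, exists x, X x /\ '[v - x, v - x] < d + n.+1%:R^-1.
  move=> n; have [|x Xx hx] := dlt n.+1%:R^-1; last by exists x.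
  by rewrite invr_gt0 ltr0Sn.
have XD x y : X x -> X y -> X (x + y).
  by move=> Xx Xy; rewrite -[x]scale1r; exact: Xlin.
have XZ a x : X x -> X (a *: x) by move=> Xx; rewrite -[_ *: _]addr0; exact: Xlin.
have [l ul] : exists l, seq_cvg_to ip u l.
  apply: completeH => e e0.
  (* The estimate below bounds the squared distance of two terms by four times [N.+1%:R^-1], hence
     the 4. *)
  have [N hN] := natV_small (divr_gt0 (exprn_gt0 2 e0) (ltr0Sn _ 3)).
  exists N => m n Nm Nn; rewrite hnorm_ltE//.
  have := parallelogram (v - u n) (v - u m).
  have -> : (v - u n) - (v - u m) = u m - u n.
    by rewrite opprB [LHS]addrC addrA subrK.
  move/(canRL (addKr _)) => ->.
  (* The midpoint of two terms lies in [X], so its squared distance to [v] is at least [d]. *)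
  have -> : (v - u n) + (v - u m) = 2 *: (v - 2^-1 *: (u n + u m)).
    rewrite scalerBr scalerA mulfV ?pnatr_eq0// scale1r.
    by rewrite -[2]/(1 + 1) scalerDl scale1r opprD addrACA.
  have mid : d <= '[v - 2^-1 *: (u n + u m), v - 2^-1 *: (u n + u m)].
    by apply/dle/XZ/XD; apply: (hu _).1.
  rewrite ipZl ipZr conjC_nat; move: mid; set M := ip _ _ => mid.
  have dn := lt_le_trans (hu n).2 (lerD (lexx d) (natV_le Nn)).
  have dm := lt_le_trans (hu m).2 (lerD (lexx d) (natV_le Nm)).
  rewrite addrC ltrBlDr.
  have h : 2 * ('[v - u n, v - u n] + '[v - u m, v - u m]) <
      2 * (d + N.+1%:R^-1 + (d + N.+1%:R^-1)).
    by rewrite ltr_pM2l ?ltr0Sn// ltrD.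
  apply: (lt_le_trans h); rewrite mulrA.
  have -> : 2 * (d + N.+1%:R^-1 + (d + N.+1%:R^-1)) = 4 * N.+1%:R^-1 + 2 * 2 * d
    by ring.
  apply: lerD; last by apply: ler_wpM2l; rewrite // mulr_ge0.
  by rewrite mulrC -ler_pdivlMr ?ltr0Sn// ltW.
exists l; first by apply: Xcl ul => n; exact: (hu n).1.
move=> y Xy; apply/eqP; rewrite -normr_eq0 -sqrf_eq0; apply/eqP.
apply: (@ge0_small _ (4 * '[y, y])); first exact: exprn_ge0.
  by rewrite mulr_ge0// (ip_ge0 ipP).
move=> e e0; have [N hN] := seq_cvg_sqr ul e0; have [M hM] := natV_small e0.
have := hN _ (leq_maxl N M); have := le_lt_trans (natV_le (leq_maxr N M)) hM.
set k := maxn N M => h1 h2.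
have -> : '[v - l, y] = '[v - u k, y] + '[u k - l, y].
  by rewrite -ipDl addrA subrK.
apply: (le_trans (normD_sqr_le _ _)).
have -> : e * (4 * '[y, y]) = 2 * (e * '[y, y] + e * '[y, y]) by ring.
rewrite ler_wpM2l// lerD//; last first.
  apply: (le_trans (cauchy_schwarz _ _)); apply: ler_wpM2r; first exact: ip_ge0.
  exact: ltW.
rewrite -proj_coef_norm; apply: ler_wpM2r; first exact: ip_ge0.
apply: le_trans (ltW h1).
(* Moving [u k] along [y] cannot bring the squared distance below [d], so the component of [v - u k]
   along [y] has squared norm at most [k.+1%:R^-1]. *)
have := dle _ (XD _ _ (hu k).1 (XZ (proj_coef (v - u k) y) _ Xy)).
rewrite opprD addrA => hd.
have := ltW (hu k).2; rewrite (ipxx_proj_coef (v - u k) y) => hk.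
have := le_trans (lerD hd (lexx _)) hk.
by rewrite lerD2l.
Qed.

(** * Closed subspaces and orthogonal complements *)

Lemma csub0 (X : set H) : closed_subspace ip X -> X 0.
Proof. by case=> -[]. Qed.

Lemma csubD (X : set H) x y : closed_subspace ip X -> X x -> X y -> X (x + y).
Proof. by case=> -[_ h] _ Xx Xy; rewrite -[x]scale1r; exact: h. Qed.

Lemma csubZ (X : set H) a x : closed_subspace ip X -> X x -> X (a *: x).
Proof. by case=> -[X0 h] _ Xx; rewrite -[_ *: _]addr0; exact: h. Qed.

Lemma csubB (X : set H) x y : closed_subspace ip X -> X x -> X y -> X (x - y).
Proof.
by move=> cX Xx Xy; rewrite -scaleN1r; apply: csubD => //; exact: csubZ.
Qed.

Lemma csubI (X Y : set H) :
  closed_subspace ip X -> closed_subspace ip Y -> closed_subspace ip (X `&` Y).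
Proof.
move=> [[X0 Xl] Xc] [[Y0 Yl] Yc]; split; first split=> //.
  by move=> a x y [Xx Yx] [Xy Yy]; split; [exact: Xl | exact: Yl].
by move=> u l ul cl; split; [apply: Xc cl | apply: Yc cl] => n; case: (ul n).
Qed.

Lemma csub_orth (A : set H) : closed_subspace ip (orth A).
Proof.
split; first split=> [y _|a x y Ax Ay z Az].
- exact: ip0l.
- by rewrite !ipE Ax ?Ay// mulr0 addr0.
- by move=> u l ul cl y Ay; apply: (cvg_ip_eq0 cl) => n; exact: ul.
Qed.
Hint Resolve csub_orth : core.

Lemma orthS (A B : set H) : A `<=` B -> orth B `<=` orth A.
Proof. by move=> AB x Bx y /AB; exact: Bx. Qed.

Lemma sub_orth_orth (A : set H) : A `<=` orth (orth A).
Proof. by move=> x Ax y Ay; apply: ip_orthC; exact: Ay. Qed.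

Lemma orth_self (X : set H) x : X x -> orth X x -> x = 0.
Proof. by move=> Xx /(_ x Xx) /(ip_def ipP). Qed.

(** For [v] in the double complement, [v] minus its projection to [X] is orthogonal to itself. *)
Lemma orthK (X : set H) : closed_subspace ip X -> orth (orth X) = X.
Proof.
move=> cX; apply/seteqP; split; last exact: sub_orth_orth.
move=> v ov; have [x Xx ox] := projection v cX.
suff -> : v = x by [].
apply/eqP; rewrite -subr_eq0; apply/eqP; apply: (orth_self ox).
by apply: (csubB (csub_orth _)) => //; exact: sub_orth_orth.
Qed.

Lemma orth1E v w : orth [set v] w <-> '[w, v] = 0.
Proof. by split=> [|h _ ->//]; apply. Qed.

(** * Adjoining a vector to a closed subspace *)

Definition adj (X : set H) (v : H) : set H :=
  [set z | exists x a, X x /\ z = x + a *: v].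

Lemma sub_adj X v : X `<=` adj X v.
Proof. by move=> x Xx; exists x, 0; rewrite scale0r addr0. Qed.

Lemma adj_mem X v : closed_subspace ip X -> adj X v v.
Proof. by move=> /csub0 X0; exists 0, 1; rewrite scale1r add0r. Qed.

Lemma adjS X Y v : X `<=` Y -> adj X v `<=` adj Y v.
Proof. by move=> XY _ [x [a [/XY Yx ->]]]; exists x, a. Qed.

Lemma adj_sub X Y v : closed_subspace ip Y -> X `<=` Y -> Y v -> adj X v `<=` Y.
Proof.
by move=> cY XY Yv _ [x [a [/XY Xx ->]]]; apply: csubD => //; exact: csubZ.
Qed.

Lemma orth_adj X p y : orth X y -> '[y, p] = 0 -> orth (adj X p) y.
Proof.
by move=> oy yp _ [x [a [Xx ->]]]; rewrite !ipE oy// yp mulr0 addr0.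
Qed.

(** The extension is closed because it is itself an orthogonal complement, namely that of the
    vectors orthogonal to both [X] and [v]. *)
Lemma csub_adj X v : closed_subspace ip X -> closed_subspace ip (adj X v).
Proof.
move=> cX; suff -> : adj X v = orth (orth X `&` orth [set v]) by [].
apply/seteqP; split=> [_ [x [a [Xx ->]]] y [oX /orth1E ov]|z oz].
  apply: ip_orthC; rewrite !ipE oX// ov; ring.
have [p Xp op] := projection v cX; have [x Xx ox] := projection z cX.
set q := v - p in op.
set c := proj_coef (z - x) q.
have h : orth X (z - x - c *: q).
  by apply: (csubB (csub_orth _)) => //; exact: (csubZ _ (csub_orth _)).
suff /eqP : z - x - c *: q = 0.
  rewrite subr_eq0 subr_eq => /eqP ->; exists (x - c *: p), c; split.
    by apply: csubB => //; exact: csubZ.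
  by rewrite /q scalerBr addrC -!addrA; congr (_ + _); rewrite addrC.
have hq : '[z - x - c *: q, q] = 0 by exact: proj_coef_orth.
have hv : '[z - x - c *: q, v] = 0.
  by rewrite -(subrK p v) ipDr hq h// addr0.
apply: (ip_def ipP); clearbody c q; move er: (z - x - c *: q) h hq hv => r h hq hv.
have ez : z = r + c *: q + x by rewrite -er !subrK.
(* The residue [r] is orthogonal to [X] and [v], hence to [z]; since [z] is [r] plus terms
   orthogonal to [r], it follows that [r] is orthogonal to itself. *)
have := oz r (conj h ((orth1E _ _).2 hv)); rewrite ez !ipE.
by rewrite (ip_orthC hq) (ip_orthC (h _ Xx)) mulr0 !addr0.
Qed.

Lemma adj_projE X v p : closed_subspace ip X -> X (v - p) -> adj X v = adj X p.
Proof.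
move=> cX Xvp; apply/seteqP; split=> _ [x [a [Xx ->]]].
  exists (x + a *: (v - p)), a; split; first by apply: csubD => //; exact: csubZ.
  by rewrite scalerBr -addrA subrK.
exists (x - a *: (v - p)), a; split; first by apply: csubB => //; exact: csubZ.
by rewrite scalerBr opprB addrA subrK.
Qed.

Lemma adj_inj X v w : closed_subspace ip X -> orth X v -> orth X w ->
  adj X w v -> exists c, v = c *: w.
Proof.
move=> cX ov ow [x [c [Xx e]]]; exists c.
have ox : orth X x.
  have -> : x = v - c *: w by rewrite e addrK.
  by apply: (csubB (csub_orth _)) => //; exact: (csubZ _ (csub_orth _)).
by rewrite e (orth_self Xx ox) add0r.
Qed.

(** Presents [X] as a one-dimensional extension of a subspace orthogonal to [v], the form in which
    [f] can be evaluated. *)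
Lemma adj_capK X v : closed_subspace ip X -> X v ->
  adj (X `&` orth [set v]) v = X.
Proof.
move=> cX Xv; apply/seteqP; split; first by apply: adj_sub => // x [].
move=> x Xx; exists (x - proj_coef x v *: v), (proj_coef x v); rewrite subrK; split=> //.
split; first by apply: csubB => //; exact: csubZ.
by apply/orth1E; exact: proj_coef_orth.
Qed.

(** * Infinite-dimensional subspaces *)

Lemma finspan0 : finspan [::] = [set (0 : H)].
Proof.
apply/seteqP; split=> [x [c ->]|_ ->]; first by rewrite big_ord0.
by exists (fun=> 0); rewrite big_ord0.
Qed.

Lemma finspan_cons a (s : seq H) : finspan (a :: s) = adj (finspan s) a.
Proof.
apply/seteqP; split=> [x [c ->]|_ [_ [b [[c ->] ->]]]].
  rewrite /= big_ord_recl /= addrC; eexists _, (c 0%N); split; last by [].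
  by exists (fun i => c i.+1).
exists (fun i => if i is j.+1 then c j else b).
by rewrite /= big_ord_recl /= addrC.
Qed.

Lemma setsum0 (X : set H) : setsum X [set 0] = X.
Proof.
apply/seteqP; split=> [_ [x [_ [Xx [-> ->]]]]|x Xx]; first by rewrite addr0.
by exists x, 0; rewrite addr0.
Qed.

Lemma setsum_adj (X Y : set H) a : setsum X (adj Y a) = adj (setsum X Y) a.
Proof.
apply/seteqP; split=> [_ [x [_ [Xx [[y [c [Yy ->]]] ->]]]]|_ [_ [c [[x [y [Xx [Yy ->]]]] ->]]]].
  by exists (x + y), c; split; [exists x, y | rewrite addrA].
by exists x, (y + c *: a); split=> //; split; [exists y, c | rewrite addrA].
Qed.

(* For a subspace this says that the dimension is infinite; in this form the
   property passes to larger sets, hence [Ginf] to closed spans. *)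
Definition big (X : set H) : Prop := forall s : seq H,
  exists x, [/\ X x, x != 0 & forall y, y \in s -> '[x, y] = 0].

Lemma bigS (X Y : set H) : X `<=` Y -> big X -> big Y.
Proof. by move=> XY bX s; have [x [/XY]] := bX s; exists x. Qed.

Lemma big_cap_orth (X : set H) v : big X -> big (X `&` orth [set v]).
Proof.
move=> bX s; have [x [Xx x0 h]] := bX (v :: s); exists x; split=> //.
  by split=> //; apply/orth1E/h; rewrite mem_head.
by move=> y ys; apply: h; rewrite inE ys orbT.
Qed.

Lemma orth_finspan (s : seq H) x :
  (forall y, y \in s -> '[x, y] = 0) -> orth (finspan s) x.
Proof.
elim: s => [|a s IH] h; first by rewrite finspan0 => _ ->; exact: ip0r.
rewrite finspan_cons; apply: orth_adj; last by apply: h; rewrite mem_head.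
by apply: IH => y ys; apply: h; rewrite inE ys orbT.
Qed.

Lemma big_inf_dim (X : set H) : big X -> inf_dim X.
Proof.
move=> bX [s Xs]; have [x [Xx /eqP x0 /orth_finspan h]] := bX s.
by apply: x0; apply: orth_self h; rewrite -Xs.
Qed.

(** Each vector of [s] imposes one linear condition on [X], and all the conditions together leave
    only 0; the induction removes one condition at a time. *)
Lemma fin_dim_of_orth (s : seq H) (X : set H) : subspace X ->
  (forall x, X x -> (forall y, y \in s -> '[x, y] = 0) -> x = 0) ->
  exists t, X = finspan t.
Proof.
elim: s X => [|a s IH] X [X0 Xl] h.
  exists [::]; rewrite finspan0; apply/seteqP; split=> [x Xx|_ ->//].
  exact: h.
have [||t et] := IH (X `&` orth [set a]).
- split; first by split=> //; apply/orth1E; exact: ip0l.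
  move=> c x y [Xx /orth1E ox] [Xy /orth1E oy]; split; first exact: Xl.
  by apply/orth1E; rewrite !ipE ox oy mulr0 addr0.
- move=> x [Xx /orth1E ox] hx; apply: h => // y; rewrite inE => /predU1P[->//|].
  exact: hx.
(* Either [a] imposes no condition on [X], or one vector [x0] violating it spans [X] modulo the part
   orthogonal to [a]. *)
have [[x0 Xx0 nx0]|nx] := pselect (exists2 x, X x & '[x, a] != 0); last first.
  exists t; rewrite -et; apply/seteqP; split=> [x Xx|x []//]; split=> //.
  by apply/orth1E; apply: contrapT => /eqP hx; apply: nx; exists x.
exists (x0 :: t); rewrite finspan_cons -et; apply/seteqP; split=> [x Xx|].
  exists (x - ('[x, a] / '[x0, a]) *: x0), ('[x, a] / '[x0, a]).
  rewrite subrK; split=> //; split.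
    by rewrite addrC -scaleNr; exact: Xl.
  by apply/orth1E; rewrite !ipE divfK// subrr.
by move=> _ [y [c [[Xy _] ->]]]; rewrite addrC; exact: Xl.
Qed.

Lemma inf_dim_big (X : set H) : subspace X -> inf_dim X -> big X.
Proof.
move=> sX iX s; apply: contrapT => h; apply: iX.
apply: (fin_dim_of_orth (s := s) sX) => x Xx hx.
apply: contrapT => /eqP x0; apply: h; by exists x.
Qed.

(** Orthogonal projection turns infinite codimension into infinite dimension of the complement,
    which makes the condition symmetric in [X] and [orth X]. *)
Lemma GinfP (X : set H) :
  Ginf ip X <-> [/\ closed_subspace ip X, big X & big (orth X)].
Proof.
split=> [[cX [iX cdX]]|[cX bX boX]].
  split=> //; first by apply: inf_dim_big => //; case: cX.
  apply: inf_dim_big; first by case: (csub_orth X).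
  move=> [s es]; apply: cdX; exists s; apply/seteqP; split=> // v _.
  have [x Xx ox] := projection v cX; exists x, (v - x).
  by rewrite -es addrCA subrr addr0.
split=> //; split; first exact: big_inf_dim.
move=> [s es]; have [x [ox /eqP x0 /orth_finspan os]] := boX s.
have : setsum X (finspan s) x by rewrite -es.
move=> [a [b [Xa [sb e]]]]; apply: x0; apply: (ip_def ipP).
by rewrite {2}e ipDr ox// os// addr0.
Qed.

Lemma Ginf_csub X : Ginf ip X -> closed_subspace ip X.
Proof. by case. Qed.
Hint Resolve Ginf_csub : core.

Lemma Ginf_between (X Y : set H) Z : closed_subspace ip X -> big Y -> Y `<=` X ->
  Ginf ip Z -> X `<=` Z -> Ginf ip X.
Proof.
move=> cX bY YX /GinfP[_ _ bZ] XZ; apply/GinfP; split=> //.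
  exact: bigS bY.
exact: bigS (orthS XZ) bZ.
Qed.

Lemma Ginf_adj X v : Ginf ip X -> Ginf ip (adj X v).
Proof.
move=> /GinfP[cX bX boX]; apply/GinfP; split; first exact: csub_adj.
  exact: bigS (@sub_adj X v) bX.
apply: bigS (big_cap_orth v boX) => x [ox /orth1E ov]; exact: orth_adj.
Qed.

Lemma Ginf_cap X v : Ginf ip X -> Ginf ip (X `&` orth [set v]).
Proof.
move=> gX; have /GinfP[cX bX _] := gX; have bc := big_cap_orth v bX.
by apply: (Ginf_between (csubI cX (csub_orth _)) bc _ gX) => // x [].
Qed.

Lemma Ginf_orth X : Ginf ip X -> Ginf ip (orth X).
Proof. by move=> /GinfP[cX bX boX]; apply/GinfP; rewrite orthK. Qed.

Lemma orth_seq (X Y : set H) : big X -> big Y -> exists u : nat -> H,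
  [/\ forall n, u n != 0, forall m n, m != n -> '[u m, u n] = 0,
      forall n, ~~ odd n -> X (u n) & forall n, odd n -> Y (u n)].
Proof.
move=> bX bY.
have /choice[g hg] : forall bs : bool * seq H, exists x,
    [/\ (if bs.1 then Y else X) x, x != 0 & forall y, y \in bs.2 -> '[x, y] = 0].
  by case=> -[] s; [exact: bY | exact: bX].
(* [hist n] lists the terms of index below [n]; the next term is orthogonal to all of them and is
   taken from [X] or [Y] by parity. *)
pose fix hist n := if n is m.+1 then g (odd m, hist m) :: hist m else [::].
pose u n := g (odd n, hist n).
have uh m n : (m < n)%N -> u m \in hist n.
  elim: n => // n IH; rewrite ltnS leq_eqVlt => /predU1P[->|/IH h].
    by rewrite mem_head.
  by rewrite inE h orbT.
exists u; split=> [n|m n|n /negbTE on|n on].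
- by case: (hg (odd n, hist n)).
- have uo i j : (i < j)%N -> '[u j, u i] = 0.
    by move=> /uh h; case: (hg (odd j, hist j)) => _ _; apply.
  by case: ltngtP => // /uo // h _; exact: ip_orthC.
- by have [h _ _] := hg (odd n, hist n); move: h; rewrite /= {1}on.
- by have [h _ _] := hg (odd n, hist n); move: h; rewrite /= {1}on.
Qed.

(** Orthogonality to one more vector is reached by combining the terms of the sequence in
    consecutive pairs, which leaves an infinite orthogonal sequence in [W]. *)
Lemma big_of_orth_seq (W : set H) (u : nat -> H) : closed_subspace ip W ->
  (forall n, u n != 0) -> (forall m n, m != n -> '[u m, u n] = 0) ->
  (forall n, W (u n)) -> big W.
Proof.
move=> cW u0 uo uW s.
suff [v [v0 _ vW vs]] : exists v : nat -> H, [/\ forall n, v n != 0,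
    forall m n, m != n -> '[v m, v n] = 0, forall n, W (v n) &
    forall n y, y \in s -> '[v n, y] = 0].
  by exists (v 0%N); split; [exact: vW | exact: v0 | exact: vs].
elim: s => [|a s [v [v0 vo vW vs]]]; first by exists u.
(* With these coefficients the combination of [v n.*2] and [v n.*2.+1] is orthogonal to [a]. The
   value 1 keeps it nonzero when [v n.*2] is already orthogonal to [a]. *)
pose c n : R[i] := if '[v n.*2, a] == 0 then 1 else '[v n.*2.+1, a].
pose d n : R[i] := - '[v n.*2, a].
have dne m n : (m.*2 != n.*2.+1)%N.
  by apply/eqP => /(congr1 odd); rewrite /= !odd_double.
have vv n : '[v n.*2, v n.*2.+1] = 0 by exact: vo.
have vv' n : '[v n.*2.+1, v n.*2] = 0 by exact: ip_orthC.
exists (fun n => c n *: v n.*2 + d n *: v n.*2.+1); split=> [n|m n mn|n|n y].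
- have [e|ne] := eqVneq '[v n.*2, a] 0.
    by rewrite /c /d e eqxx oppr0 scale1r scale0r addr0.
  apply/eqP => /(congr1 (fun x => '[x, v n.*2.+1])).
  rewrite !ipE vv mulr0 add0r => /eqP; rewrite mulf_eq0 oppr_eq0 (negbTE ne)/=.
  by rewrite ipxx_eq0 (negbTE (v0 _)).
- have e0 : '[v m.*2, v n.*2] = 0 by apply: vo; lia.
  have e1 : '[v m.*2, v n.*2.+1] = 0 by apply: vo; lia.
  have e2 : '[v m.*2.+1, v n.*2] = 0 by apply: vo; lia.
  have e3 : '[v m.*2.+1, v n.*2.+1] = 0 by apply: vo; lia.
  by rewrite !ipE e0 e1 e2 e3; ring.
- by apply: csubD => //; exact: csubZ.
rewrite inE => /predU1P[->|ys]; last by rewrite !ipE !vs// !mulr0 addr0.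
rewrite !ipE /c /d; case: eqVneq => [->|_]; ring.
Qed.

(* The closed spans of two disjoint parts of an orthogonal sequence taken
   alternately from [X] and [Y]. *)
Lemma Ginf_link (X Y : set H) : closed_subspace ip X -> closed_subspace ip Y ->
  big X -> big Y -> exists Z1 Z2 Z,
  [/\ Ginf ip Z1, Ginf ip Z2 & Ginf ip Z] /\
  [/\ Z1 `<=` X, Z2 `<=` Y, Z1 `<=` Z, Z2 `<=` Z &
      orth X `&` orth Y `<=` orth Z].
Proof.
move=> cX cY bX bY; have [u [u0 uo uX uY]] := orth_seq bX bY.
have od n k : odd (n.*2.*2 + k) = odd k by rewrite oddD odd_double.
(* Indices congruent to [k] modulo 4: class 0 is even and lies in [X], class 1 is odd and lies in
   [Y], and class 2 is left over to make the complement of [Z] infinite-dimensional. *)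
pose S k := [set x | exists n, x = u (n.*2.*2 + k)%N].
have bS k (W : set H) : closed_subspace ip W -> S k `<=` W -> big W.
  move=> cW SW; apply: (@big_of_orth_seq _ (fun n => u (n.*2.*2 + k)%N)) => //.
    by move=> m n mn; apply: uo; rewrite eqn_add2r !(inj_eq double_inj).
  by move=> n; apply: SW; exists n.
have S0X : S 0%N `<=` X by move=> _ [n ->]; apply: uX; rewrite od.
have S1Y : S 1%N `<=` Y by move=> _ [n ->]; apply: uY; rewrite od.
pose cl A := orth (orth A).
have clS A B : A `<=` B -> cl A `<=` cl B by move=> /orthS/orthS.
pose Z := cl (S 0%N `|` S 1%N).
have Z0 : cl (S 0%N) `<=` Z by apply: clS; exact: subsetUl.
have Z1 : cl (S 1%N) `<=` Z by apply: clS; exact: subsetUr.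
have cZ : closed_subspace ip Z by exact: csub_orth.
have gZ : Ginf ip Z.
  apply/GinfP; split; first exact: cZ.
    apply: (@bS 0%N) => //; apply: subset_trans Z0; exact: sub_orth_orth.
  apply: (@bS 2%N); first exact: csub_orth.
  apply: (@subset_trans _ (orth (S 0%N `|` S 1%N))); last exact: sub_orth_orth.
  have ne k n m : (k < 2)%N -> (n.*2.*2 + 2 != m.*2.*2 + k)%N.
    by move=> k2; apply/eqP => /(congr1 (fun i => i./2)); lia.
  by move=> _ [n ->] _ [] [m ->]; apply: uo; apply: ne.
have gcl k : (k < 2)%N -> cl (S k) `<=` Z -> Ginf ip (cl (S k)).
  move=> k2 SZ; have b : big (cl (S k)) by apply: (@bS k); [exact: csub_orth | exact: sub_orth_orth].
  exact: (Ginf_between (csub_orth _) b (@subset_refl _ _) gZ SZ).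
exists (cl (S 0%N)), (cl (S 1%N)), Z; split; split=> //; try exact: gcl.
- by rewrite -(orthK cX); exact: clS.
- by rewrite -(orthK cY); exact: clS.
- rewrite /Z /cl => x [xX xY]; apply: sub_orth_orth => y [/S0X|/S1Y]; [exact: xX | exact: xY].
Qed.

(** * Wigner's theorem *)

Section Wigner.
Variables (T : H -> H) (e : H).
Hypothesis Tip : forall x y, `|'[T x, T y]| = `|'[x, y]|.
Hypothesis e1 : '[e, e] = 1.

Lemma wigner_norm x : '[T x, T x] = '[x, x].
Proof. by have := Tip x x; rewrite !ger0_norm// (ip_ge0 ipP). Qed.

(** Both vectors attain equality in Cauchy-Schwarz because [T] preserves moduli. *)
Lemma wigner_ray a x : a != 0 -> exists c, T x = c *: T (a *: x).
Proof.
move=> a0; have [x0|x0] := eqVneq x 0.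
  exists 0; rewrite scale0r; apply/eqP.
  by rewrite -ipxx_eq0 wigner_norm x0 ip0l.
exists (proj_coef (T x) (T (a *: x))); apply: cauchy_schwarz_eq.
  by rewrite -ipxx_eq0 wigner_norm ipxx_eq0 scaler_eq0 negb_or a0.
rewrite Tip !wigner_norm !ipE normrM norm_conjC (ger0_norm (ip_ge0 ipP _)).
by rewrite exprMn normCK; ring.
Qed.

(* Bargmann's normalisation: for [z] orthogonal to the unit vector [e], the ray
   of [e + z] is sent to the ray of [T e + wig z]. *)
Definition wig z := locked ('[T (e + z), T e]^* *: T (e + z) - T e).

Lemma wigE z : wig z = '[T (e + z), T e]^* *: T (e + z) - T e.
Proof. by rewrite /wig -lock. Qed.

Lemma wig_phase z : '[z, e] = 0 -> `|'[T (e + z), T e]| = 1.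
Proof. by move=> ze; rewrite Tip ipDl ze e1 addr0 normr1. Qed.

Lemma wig_orth z : '[z, e] = 0 -> '[wig z, T e] = 0.
Proof.
move=> ze; rewrite wigE !ipE wigner_norm e1 mulrC -normCK wig_phase//.
by rewrite expr1n subrr.
Qed.

Lemma wig_orth' z : '[z, e] = 0 -> '[T e, wig z] = 0.
Proof. by move=> ze; apply/ip_orthC/wig_orth. Qed.

(** Both sides are moduli of inner products of vectors with component [e], respectively [T e]; the
    normalising phases have modulus 1 and drop out. *)
Lemma wig_norm1D z w : '[z, e] = 0 -> '[w, e] = 0 ->
  `|1 + '[wig z, wig w]| = `|1 + '[z, w]|.
Proof.
move=> ze we; have ez := ip_orthC ze; have ew := ip_orthC we.
have -> : 1 + '[z, w] = '[e + z, e + w] by rewrite !ipE e1 ze ew; ring.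
rewrite -Tip; have -> : 1 + '[wig z, wig w] = '[T e + wig z, T e + wig w].
  by rewrite ipDl !ipDr wigner_norm e1 wig_orth// wig_orth'//; ring.
rewrite !wigE ![T e + _]addrC !subrK ipZl ipZr !normrM !norm_conjC.
by rewrite !wig_phase// !mul1r.
Qed.

Lemma wig_norm z : '[z, e] = 0 -> '[wig z, wig z] = '[z, z].
Proof.
move=> ze; have := wig_norm1D ze ze.
by rewrite !ger0_norm ?addr_ge0 ?(ip_ge0 ipP)// => /addrI.
Qed.

(** Equality in Cauchy-Schwarz: [wig] only changes the representative of the ray of [T z]. *)
Lemma wig_ray z : '[z, e] = 0 -> exists2 c, `|c| = 1 & wig z = c *: T z.
Proof.
move=> ze; have [z0|z0] := eqVneq z 0.
  exists 1; first exact: normr1.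
  transitivity (0 : H).
    by apply/eqP; rewrite -ipxx_eq0 wig_norm// z0 ip0l.
  by apply/esym/eqP; rewrite scale1r -ipxx_eq0 wigner_norm z0 ip0l.
have Tz0 : T z != 0 by rewrite -ipxx_eq0 wigner_norm ipxx_eq0.
have h : wig z = proj_coef (wig z) (T z) *: T z.
  apply: cauchy_schwarz_eq => //.
  have -> : '[wig z, T z] = '[T (e + z), T e]^* * '[T (e + z), T z].
    rewrite wigE !ipE; have -> : '[T e, T z] = 0 by
      apply/eqP; rewrite -normr_eq0 Tip (ip_orthC ze) normr0.
    by rewrite subr0.
  rewrite normrM norm_conjC wig_phase// mul1r Tip ipDl (ip_orthC ze) add0r.
  by rewrite ger0_norm ?(ip_ge0 ipP)// wig_norm// wigner_norm expr2.
exists (proj_coef (wig z) (T z)) => //; apply/eqP.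
rewrite -(eqrXn2 (n := 2))// expr1n; apply/eqP.
apply: (mulIf (x := '[z, z])); first by rewrite ipxx_eq0.
by rewrite mul1r -{2}(wig_norm ze) {2 3}h !ipE wigner_norm normCK; ring.
Qed.

Lemma wig_normip z w : '[z, e] = 0 -> '[w, e] = 0 ->
  `|'[wig z, wig w]| = `|'[z, w]|.
Proof.
move=> /wig_ray[c c1 ->] /wig_ray[d d1 ->].
by rewrite !ipE !normrM norm_conjC c1 d1 !mul1r Tip.
Qed.

(** The moduli of [t] and [1 + t] determine the real part of [t]. *)
Lemma wig_re z w : '[z, e] = 0 -> '[w, e] = 0 ->
  '[wig z, wig w] + '[wig w, wig z] = '[z, w] + '[w, z].
Proof.
move=> ze we; rewrite -(ip_conj (wig z) (wig w)) -(ip_conj z w).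
have := congr1 (fun t => t ^+ 2) (wig_norm1D ze we).
have := congr1 (fun t => t ^+ 2) (wig_normip ze we).
move: '[wig z, wig w] '[z, w] => a b.
rewrite /= !normCK !rmorphD !rmorph1 => h.
have -> : (1 + a) * (1 + a^*) = a + a^* + (1 + a * a^*) by ring.
have -> : (1 + b) * (1 + b^*) = b + b^* + (1 + b * b^*) by ring.
by rewrite h => /addIr.
Qed.

(** The squared norm of the difference of the two sides involves only norms and real parts of inner
    products, all of which [wig] preserves. *)
Lemma wigD z w : '[z, e] = 0 -> '[w, e] = 0 -> wig (z + w) = wig z + wig w.
Proof.
move=> ze we; have se : '[z + w, e] = 0 by rewrite ipDl ze we addr0.
apply/eqP; rewrite -subr_eq0 -ipxx_eq0; apply/eqP.
have h1 := wig_re se ze; have h2 := wig_re se we; have h3 := wig_re ze we.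
have n1 := wig_norm se; have n2 := wig_norm ze; have n3 := wig_norm we.
move: (wig (z + w)) (wig z) (wig w) h1 h2 h3 n1 n2 n3 => s a b h1 h2 h3 n1 n2 n3.
transitivity ('[s, s] + '[a, a] + '[b, b] - ('[s, a] + '[a, s])
  - ('[s, b] + '[b, s]) + ('[a, b] + '[b, a])); first by rewrite !ipE; ring.
by rewrite h1 h2 h3 n1 n2 n3 !ipE; ring.
Qed.

Lemma wigZ_real r z : r^* = r -> '[z, e] = 0 -> wig (r *: z) = r *: wig z.
Proof.
move=> rr ze; have se : '[r *: z, e] = 0 by rewrite ipZl ze mulr0.
apply/eqP; rewrite -subr_eq0 -ipxx_eq0; apply/eqP.
have h1 := wig_re se ze; have n1 := wig_norm se; have n2 := wig_norm ze.
move: (wig (r *: z)) (wig z) h1 n1 n2 => s a h1 n1 n2.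
transitivity ('[s, s] + r * r * '[a, a] - r * ('[s, a] + '[a, s])).
  by rewrite !ipE rr; ring.
by rewrite h1 n1 n2 !ipE rr; ring.
Qed.

(** The inner product of [wig ('i *: z)] with [wig z] is purely imaginary with the modulus of
    ['[z, z]], so only its sign is free. *)
Lemma wig_i z : '[z, e] = 0 ->
  wig ('i *: z) = 'i *: wig z \/ wig ('i *: z) = - 'i *: wig z.
Proof.
move=> ze; have se : '[ 'i *: z, e] = 0 by rewrite ipZl ze mulr0.
have h1 := wig_re se ze; have n1 := wig_norm se; have n2 := wig_norm ze.
have h2 := congr1 (fun t => t ^+ 2) (wig_normip se ze).
have i2 : ('i : R[i]) * 'i = -1 by rewrite -expr2 sqrCi.
rewrite /= ipZl normrM exprMn normCi expr1n mul1r (ger0_norm (ip_ge0 ipP _)) in h2.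
move: (wig ('i *: z)) (wig z) h1 n1 n2 h2 => s a.
rewrite !ipE conjCi normCK -(ip_conj s a) => h1 n1 n2 h2.
have ha : '[s, a]^* = - '[s, a].
  by apply/eqP; rewrite -addr_eq0 addrC h1; apply/eqP; ring.
have n1' : '[s, s] = '[z, z].
  by rewrite n1; transitivity (- ('i * 'i) * '[z, z]); [ring | rewrite i2; ring].
have : ('[s, a] - 'i * '[z, z]) * ('[s, a] + 'i * '[z, z]) = 0.
  transitivity (- ('[s, a] * '[s, a]^*) - 'i * 'i * '[z, z] ^+ 2).
    by rewrite ha; ring.
  by rewrite h2 i2; ring.
have key k : k * k = -1 -> k^* = - k -> '[s, a] = k * '[z, z] -> s = k *: a.
  move=> k2 kc hk; apply/eqP; rewrite -subr_eq0 -ipxx_eq0; apply/eqP.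
  transitivity ('[s, s] + k * '[s, a] - k * '[s, a]^* - k * k * '[a, a]).
    by rewrite ip_conj !ipE kc; ring.
  rewrite ha hk n1' n2.
  transitivity ('[z, z] * (1 + k * k)); first ring.
  by rewrite k2; ring.
move/eqP; rewrite mulf_eq0 => /orP[|]; rewrite ?subr_eq0 ?addr_eq0 => /eqP hs.
  by left; apply: key => //; rewrite conjCi.
right; apply: key; [by rewrite mulrNN | by rewrite rmorphN /= conjCi | by rewrite hs mulNr].
Qed.

Lemma wig_semilinear : exists s : R[i] -> R[i],
  ((s = id) \/ (s = fun a => a^*)) /\
  forall a z, '[z, e] = 0 -> wig (a *: z) = s a *: wig z.
Proof.
have red j : (forall z, '[z, e] = 0 -> wig ('i *: z) = j *: wig z) ->
    forall a z, '[z, e] = 0 -> wig (a *: z) = ('Re a + 'Im a * j) *: wig z.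
  move=> hj a z ze; have iz : '[ 'i *: z, e] = 0 by rewrite ipZl ze mulr0.
  have -> : a *: z = 'Re a *: z + 'Im a *: ('i *: z).
    by rewrite scalerA -scalerDl mulrC -Crect.
  have reC : ('Re a)^* = 'Re a by apply/CrealP; exact: Creal_Re.
  have imC : ('Im a)^* = 'Im a by apply/CrealP; exact: Creal_Im.
  rewrite wigD ?ipZl ?ze ?iz ?mulr0//.
  by rewrite (wigZ_real reC ze) (wigZ_real imC iz) hj// scalerA -scalerDl.
have [all_i|] := pselect (forall z, '[z, e] = 0 -> wig ('i *: z) = 'i *: wig z).
  exists id; split; first by left.
  by move=> a z /(red 'i all_i) ->; rewrite [in RHS](Crect a) mulrC.
move=> /existsNP[z /not_implyP[ze nz]].
have hz : wig ('i *: z) = - 'i *: wig z by case: (wig_i ze).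
exists (fun a => a^*); split; first by right.
move=> a w we; rewrite (red (- 'i)) => [|v ve|//].
  have reC : ('Re a)^* = 'Re a by apply/CrealP; exact: Creal_Re.
  have imC : ('Im a)^* = 'Im a by apply/CrealP; exact: Creal_Im.
  by rewrite [in RHS](Crect a) rmorphD rmorphM /= conjCi reC imC mulrC.
have [hv|//] := wig_i ve.
(* The sign at [z + v] decides: plus contradicts the sign at [z], and minus gives the claim at [v].
   Hence the sign is the same for all vectors. *)
have zve : '[z + v, e] = 0 by rewrite ipDl ze ve addr0.
have iz0 : '[ 'i *: z, e] = 0 by rewrite ipZl ze mulr0.
have iv0 : '[ 'i *: v, e] = 0 by rewrite ipZl ve mulr0.
have := wig_i zve; rewrite scalerDr !wigD// hz hv !scalerDr => -[|].
  by move/addIr => h; case: nz; rewrite hz h.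
by move/addrI.
Qed.

Lemma wigner : exists L : H -> H,
  (linear_isometry ip L \/ conj_linear_isometry ip L) /\
  forall x, exists c, L x = c *: T x.
Proof.
have [s [sE sZ]] := wig_semilinear.
have sD a b : s (a + b) = s a + s b by case: sE => -> //; rewrite rmorphD.
have sM a b : s (a * b) = s a * s b by case: sE => -> //; rewrite rmorphM.
have s0 : s 0 = 0 by case: sE => -> //; rewrite rmorph0.
have sn a : `|s a| = `|a| by case: sE => -> //; rewrite norm_conjC.
pose P x := x - '[x, e] *: e.
have PE x : P x = x - proj_coef x e *: e by rewrite /P /proj_coef e1 divr1.
have Pe x : '[P x, e] = 0 by rewrite PE proj_coef_orth.
(* [wig] lives on the complement of [e]; the component along [e] is transported by the same scalar
   map [s]. *)
pose L x := s '[x, e] *: T e + wig (P x).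
have Ls a x y : L (a *: x + y) = s a *: L x + L y.
  have -> : L (a *: x + y) = s '[a *: x + y, e] *: T e + wig (a *: P x + P y).
    congr (_ + wig _); rewrite /P scalerBr ipDl ipZl scalerDl scalerA.
    by rewrite opprD addrACA.
  rewrite wigD ?ipZl ?Pe ?mulr0// sZ// /L ipDl ipZl sD sM.
  by rewrite scalerDl scalerDr -!scalerA -!addrA; congr (_ + _); rewrite addrCA.
have Ln : norm_preserving ip L.
  move=> x; rewrite /hnorm; congr sqrtC.
  rewrite (ipxx_proj_coef x e) -PE /L; move: (P x) (Pe x) => p pe.
  rewrite ipDl !ipDr !ipZl !ipZr wigner_norm e1 wig_orth// wig_orth'// wig_norm//.
  by rewrite /proj_coef e1 divr1 -(sn '[x, e]) normCK; ring.
exists L; split.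
  by case: sE Ls => -> Ls; [left | right].
move=> x; have [xe|xe] := eqVneq '[x, e] 0.
  rewrite /L /P xe s0 !scale0r add0r subr0.
  by have [c _ ->] := wig_ray xe; exists c.
(* Dividing [x] by its coefficient along [e] brings it to the form [e + z], on which [wig] is
   defined through [T]. *)
pose z := '[x, e]^-1 *: P x.
have ze : '[z, e] = 0 by rewrite ipZl Pe mulr0.
have -> : L x = (s '[x, e] * '[T (e + z), T e]^*) *: T (e + z).
  have -> : L x = s '[x, e] *: (T e + wig z).
    by rewrite scalerDr -sZ// /z scalerA mulfV// scale1r.
  by rewrite wigE addrC subrK scalerA.
have [c ->] := wigner_ray (e + z) xe.
have -> : '[x, e] *: (e + z) = x.
  by rewrite scalerDr /z scalerA mulfV// scale1r /P addrC subrK.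
by eexists; rewrite scalerA.
Qed.

End Wigner.

Lemma sqrC_inj (a b : R[i]) : 0 <= a -> 0 <= b -> a ^+ 2 = b ^+ 2 -> a = b.
Proof. by move=> a0 b0 /eqP; rewrite eqrXn2// => /eqP. Qed.

(** * Isometric images of subspaces *)

Lemma orth_sym (X Y : set H) : X `<=` orth Y -> Y `<=` orth X.
Proof. by move=> XY y Yy x Xx; apply/ip_orthC/XY. Qed.

Lemma lin_isometry_inj (L : H -> H) : linear_isometry ip L -> injective L.
Proof.
move=> hL x y e; have [Ll _] := hL; apply/eqP; rewrite -subr_eq0 -ipxx_eq0.
rewrite -(lin_isometry_ip hL) -scaleN1r addrC Ll e scaleN1r addrC subrr.
by rewrite ip0l.
Qed.

Lemma lin_isometry_sub (L : H -> H) (X Y : set H) : linear_isometry ip L ->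
  L @` X `<=` L @` Y <-> X `<=` Y.
Proof.
move=> hL; split=> [h x Xx|]; last exact: image_subset.
by have [y Yy /(lin_isometry_inj hL) <-] := h _ (imageP L Xx).
Qed.

Lemma lin_isometry_orth (L : H -> H) (X Y : set H) : linear_isometry ip L ->
  L @` X `<=` orth (L @` Y) <-> X `<=` orth Y.
Proof.
move=> hL; split=> [h x Xx y Yy|h _ [x Xx <-] _ [y Yy <-]].
  by rewrite -(lin_isometry_ip hL); apply: h; exact: imageP.
by rewrite lin_isometry_ip//; exact: h.
Qed.

Lemma lin_image_adj (L : H -> H) X v : linear_map L ->
  L @` (adj X v) = adj (L @` X) (L v).
Proof.
move=> Ll; apply/seteqP; split=> [_ [_ [x [a [Xx ->]]] <-]|_ [_ [a [[x Xx <-] ->]]]].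
  exists (L x), a; split; first exact: imageP.
  by rewrite addrC Ll addrC.
exists (x + a *: v); first by exists x, a.
by rewrite addrC Ll addrC.
Qed.

Lemma adj0 X : adj X 0 = X.
Proof.
apply/seteqP; split; last exact: sub_adj.
by move=> _ [x [a [Xx ->]]]; rewrite scaler0 addr0.
Qed.

Lemma adj_scale X c v : c != 0 -> adj X (c *: v) = adj X v.
Proof.
move=> c0; apply/seteqP; split=> _ [x [a [Xx ->]]].
  by exists x, (a * c); rewrite scalerA.
by exists x, (a / c); rewrite scalerA divfK.
Qed.

Lemma csubZ_inv (X : set H) c v : closed_subspace ip X -> c != 0 ->
  X (c *: v) -> X v.
Proof.
move=> cX c0 /(csubZ c^-1 cX); by rewrite scalerA mulVf// scale1r.
Qed.

Lemma exists_Ginf_orth p q : big setT ->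
  exists2 X, Ginf ip X & orth X p /\ orth X q.
Proof.
move=> bT; pose W := orth [set p] `&` orth [set q].
have cW : closed_subspace ip W by apply: csubI.
have bW : big W.
  apply: bigS (big_cap_orth q (big_cap_orth p bT)) => x [[_ xp] xq]; by split.
have [Z1 [_ [_ [[g1 _ _] [Z1W _ _ _ _]]]]] := Ginf_link cW cW bW bW.
by exists Z1 => //; split=> z /Z1W[/orth1E zp /orth1E zq]; exact: ip_orthC.
Qed.

(** * Maps preserving equivalence of pairs *)

Section EquivalentPairs.
Variable f : set H -> set H.
Hypothesis hf : forall X, Ginf ip X -> Ginf ip (f X).
Hypothesis hpair : forall X Y, Ginf ip X -> Ginf ip Y ->
  equivalent_pairs ip X Y (f X) (f Y).
Hypothesis bigT : big (@setT H).

Lemma f_inj X Y : Ginf ip X -> Ginf ip Y -> f X = f Y -> X = Y.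
Proof.
move=> gX gY; have [L [hL h]] := hpair gX gY.
by case: h => -[-> ->] e; apply/seteqP; split; apply/(lin_isometry_sub _ _ hL); rewrite e.
Qed.

Lemma f_orth X Y : Ginf ip X -> Ginf ip Y -> f X `<=` orth (f Y) <-> X `<=` orth Y.
Proof.
move=> gX gY; have [L [hL h]] := hpair gX gY.
case: h => -[-> ->]; rewrite lin_isometry_orth//.
by split; exact: orth_sym.
Qed.

(** If the isometry swaps the pair, [f (orth X)] is orthogonal to [f X] and so to its subspace
    [f Y]. Then [orth X] is orthogonal to [Y], which puts [Y] inside [X] and makes them equal. *)
Lemma f_mono X Y : Ginf ip X -> Ginf ip Y -> X `<=` Y -> f X `<=` f Y.
Proof.
move=> gX gY XY; have [L [hL h]] := hpair gX gY.
case: h => -[eX eY]; first by rewrite eX eY; apply/lin_isometry_sub.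
have YX : f Y `<=` f X by rewrite eX eY; apply/lin_isometry_sub.
have oXY : orth X `<=` orth Y.
  apply/(f_orth (Ginf_orth gX) gY); apply: subset_trans (orthS YX).
  exact/(f_orth (Ginf_orth gX) gX).
have := orth_sym oXY; rewrite (orthK (Ginf_csub gX)) => YX'.
by have -> : X = Y by apply/seteqP.
Qed.

Lemma f_mono_inv X Y : Ginf ip X -> Ginf ip Y -> f X `<=` f Y -> X `<=` Y.
Proof.
move=> gX gY XY; have [L [hL h]] := hpair gX gY.
case: h => -[eX eY]; first by apply/(lin_isometry_sub _ _ hL); rewrite -eX -eY.
have YX : Y `<=` X by apply/(lin_isometry_sub _ _ hL); rewrite -eX -eY.
by rewrite (@f_inj X Y)//; apply/seteqP; split=> //; exact: f_mono.
Qed.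

(** * Images of one-dimensional extensions *)

Definition step_image X p q :=
  [/\ '[q, q] = '[p, p], orth (f X) q & f (adj X p) = adj (f X) q].

(** The norm condition in [step_image] leaves only a phase free, and any phase is admissible. *)
Lemma step_image_scale X p q r c : step_image X p q ->
  r = c *: q -> '[r, r] = '[q, q] -> step_image X p r.
Proof.
move=> [qq oq fq] rE rr; split; first by rewrite rr.
  by rewrite rE; apply: (csubZ _ (csub_orth _)).
rewrite fq; have [c0|c0] := eqVneq c 0; last by rewrite rE adj_scale.
suff -> : q = r by [].
have /eqP : '[q, q] = 0 by rewrite -rr rE c0 scale0r ip0l.
by rewrite rE c0 scale0r ipxx_eq0 => /eqP.
Qed.

Lemma step_image_exists X p : Ginf ip X -> orth X p -> exists q, step_image X p q.
Proof.
move=> gX oX; have [->|p0] := eqVneq p 0.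
  by exists 0; split; rewrite ?adj0// => y _; exact: ip0l.
have gA := Ginf_adj p gX; have [L [hL [[eX eA]|[eX eA]]]] := hpair gX gA.
  exists (L p); split; first exact: lin_isometry_ip.
    by rewrite eX => _ [x Xx <-]; rewrite lin_isometry_ip//; exact: oX.
  by rewrite eX eA lin_image_adj//; case: hL.
(* In the swapped case monotonicity would put [p] inside [X], to which it is orthogonal. *)
have : f X `<=` f (adj X p) by apply: f_mono => //; exact: sub_adj.
rewrite eX eA lin_isometry_sub// => /(_ p (adj_mem p (Ginf_csub gX))) Xp.
by rewrite (orth_self Xp oX) eqxx in p0.
Qed.

Lemma step_image_unique X p q r : Ginf ip X ->
  step_image X p q -> step_image X p r -> exists c, r = c *: q.
Proof.
move=> gX [_ oq fq] [_ or fr]; apply: (adj_inj (Ginf_csub (hf gX))) => //.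
by rewrite -fq fr; exact: adj_mem (Ginf_csub (hf gX)).
Qed.

(* The orthogonal complements of [A] and [B] relative to their intersection
   are orthogonal, i.e. the projections onto [A] and [B] commute. *)
Definition compatible (A B : set H) := forall a b, A a -> B b ->
  orth (A `&` B) a -> orth (A `&` B) b -> '[a, b] = 0.

Lemma f_compatible A B : Ginf ip A -> Ginf ip B ->
  compatible A B -> compatible (f A) (f B).
Proof.
move=> gA gB cAB; have [L [hL h]] := hpair gA gB.
have oL X (y : H) : orth (L @` X) (L y) -> orth X y.
  by move=> h' x Xx; rewrite -(lin_isometry_ip hL); apply: h'; exact: imageP.
have sub X Y : L @` (X `&` Y) `<=` L @` X `&` L @` Y.
  by move=> _ [x [Xx Yx] <-]; split; exact: imageP.
case: h => -[-> ->] _ _ [a Aa <-] [b Bb <-] oa ob; rewrite lin_isometry_ip//.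
  by apply: cAB => //; apply: oL; apply: orthS oa || apply: orthS ob; exact: sub.
apply: ip_orthC; apply: cAB => //; rewrite setIC; apply: oL.
  by apply: orthS ob; exact: sub.
by apply: orthS oa; exact: sub.
Qed.

(** The point is that [q] is orthogonal to all of [f Y]; comparison with a vector [r] obtained
    directly from [Y] then finishes. *)
Lemma step_image_sub X Y p q : Ginf ip X -> Ginf ip Y -> X `<=` Y -> orth Y p ->
  step_image X p q -> step_image Y p q.
Proof.
move=> gX gY XY oY hq; have [qq oq fq] := hq; have oX := orthS XY oY.
have cX := Ginf_csub gX; have cfX := Ginf_csub (hf gX).
have cfY := Ginf_csub (hf gY); have gA := Ginf_adj p gX.
have [p0|p0] := eqVneq p 0.
  have q0 : q = 0 by apply: (ip_def ipP); rewrite qq p0 ip0l.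
  by split; rewrite ?p0 ?q0 ?ip0l ?adj0// => y _; exact: ip0l.
have fXY : f X `<=` f Y by exact: f_mono.
have qfY : ~ f Y q.
  move=> fYq; have : adj X p `<=` Y.
    by apply: f_mono_inv => //; rewrite fq; exact: adj_sub.
  move=> /(_ p (adj_mem p cX)) Yp.
  by rewrite (orth_self Yp oY) eqxx in p0.
have capX : f (adj X p) `&` f Y `<=` f X.
  rewrite fq => _ [[x [c [Xx ->]]] Yxc].
  have [->|c0] := eqVneq c 0; first by rewrite scale0r addr0.
  case: qfY; apply: (csubZ_inv cfY c0).
  by rewrite -[_ *: _](addrK x) addrC [_ + x]addrC addrC; apply: csubB => //; exact: fXY.
have cAY : compatible (adj X p) Y.
  move=> _ b [x [c [Xx ->]]] Yb oa _.
  have /oa : (adj X p `&` Y) x by split; [exact: sub_adj | exact: XY].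
  rewrite ipDl ipZl oX// mulr0 addr0 => /(ip_def ipP) ->.
  by rewrite add0r ipZl oY// mulr0.
have oYq : orth (f Y) q.
  (* Both [q] and the part of [y] orthogonal to [f X] are orthogonal to the intersection of
     [f (adj X p)] and [f Y], which lies in [f X]; compatibility makes them orthogonal to each
     other. *)
  move=> y fYy; have [y1 Xy1 oy] := projection y cfX.
  rewrite -(subrK y1 y) ipDr (oq y1)// addr0.
  apply: (f_compatible gA gY cAY).
  - by rewrite fq; exact: adj_mem.
  - by apply: csubB => //; exact: fXY.
  - by apply: orthS oq.
  - by apply: orthS oy.
have [r hr] := step_image_exists gY oY; have [rr or fr] := hr.
have [c qE] : exists c, q = c *: r.
  apply: (adj_inj cfY) => //; rewrite -fr.
  suff : f (adj X p) `<=` f (adj Y p) by apply; rewrite fq; exact: adj_mem.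
  by apply: f_mono => //; [exact: Ginf_adj | exact: adjS].
by apply: (step_image_scale hr qE); rewrite qq rr.
Qed.

Lemma step_image_sub_inv X Y p q : Ginf ip X -> Ginf ip Y -> X `<=` Y ->
  orth Y p -> step_image Y p q -> step_image X p q.
Proof.
move=> gX gY XY oY hq; have [r hr] := step_image_exists gX (orthS XY oY).
have hr' := step_image_sub gX gY XY oY hr.
have [c qE] := step_image_unique gY hr' hq.
by apply: (step_image_scale hr qE); case: hq hr => -> _ _ [-> _ _].
Qed.

(** The vector [q] is carried down to [Z1], up to [Z], down to [Z2] and up to [Y]. *)
Lemma step_image_indep X Y p q : Ginf ip X -> Ginf ip Y -> orth X p -> orth Y p ->
  step_image X p q -> step_image Y p q.
Proof.
move=> gX gY oX oY; have /GinfP[cX bX _] := gX; have /GinfP[cY bY _] := gY.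
have [Z1 [Z2 [Z [[g1 g2 g] [Z1X Z2Y Z1Z Z2Z /(_ p (conj oX oY)) oZ]]]]] :=
  Ginf_link cX cY bX bY.
move=> /(step_image_sub_inv g1 gX Z1X oX) /(step_image_sub g1 g Z1Z oZ).
by move=> /(step_image_sub_inv g2 g Z2Z oZ) /(step_image_sub g2 gY Z2Y oY).
Qed.

(** * The isometry induced on lines *)

Definition line_map (T : H -> H) := forall v X, Ginf ip X -> orth X v ->
  step_image X v (T v).

Lemma line_map_exists : exists T, line_map T.
Proof.
suff /choice[T hT] : forall v, exists w, forall X,
    Ginf ip X -> orth X v -> step_image X v w by exists T => v X; exact: hT.
move=> v; have [X gX [oX _]] := exists_Ginf_orth v v bigT.
have [w hw] := step_image_exists gX oX; exists w => Y gY oY.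
exact: step_image_indep hw.
Qed.

Lemma step_image_ip_dep X v w a b : Ginf ip X -> orth X v -> orth X w ->
  step_image X v a -> step_image X w b -> adj X w v -> `|'[a, b]| = `|'[v, w]|.
Proof.
move=> gX ov ow [aa oa fa] [bb ob fb] vw.
have cX := Ginf_csub gX; have cfX := Ginf_csub (hf gX).
have [c vE] := adj_inj cX ov ow vw.
have [d aE] : exists d, a = d *: b.
  apply: (adj_inj cfX) => //; rewrite -fb.
  suff : f (adj X v) `<=` f (adj X w) by apply; rewrite fa; exact: adj_mem.
  apply: f_mono; [exact: Ginf_adj | exact: Ginf_adj |].
  by apply: adj_sub => //; [exact: csub_adj | exact: sub_adj].
apply: sqrC_inj => //; move: aa; rewrite aE vE !ipE !normrM !exprMn !bb => h.
rewrite !normCK !ipxx_conj.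
transitivity (d * (d^* * '[w, w]) * '[w, w]); first ring.
by rewrite h; ring.
Qed.

(** The vectors [v'] and [w'] are [v] and [w] in either order, as the pair may be swapped. Since
    they are independent modulo [X], the two images meet only in the image of [X] under [L]. That
    image therefore contains [f X], so [L v'] and [L w'] are orthogonal to [f X]. *)
Lemma step_image_ip_iso X v w v' w' a b (L : H -> H) :
  Ginf ip X -> step_image X v a -> step_image X w b ->
  orth X v' -> orth X w' -> ~ adj X w' v' -> linear_isometry ip L ->
  f (adj X v) = L @` adj X v' -> f (adj X w) = L @` adj X w' ->
  exists c d, L v' = c *: a /\ L w' = d *: b.
Proof.
move=> gX [_ oa fa] [_ ob fb] ov ow nvw hL ev ew; have cX := Ginf_csub gX.
have cfX := Ginf_csub (hf gX).
have fXL : f X `<=` L @` X.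
  move=> z fXz.
  have : f (adj X v) z by rewrite fa; exact: sub_adj.
  have : f (adj X w) z by rewrite fb; exact: sub_adj.
  rewrite ev ew => -[u Au <-] [u' Bu' /(lin_isometry_inj hL) uu'].
  move: Bu' Au; rewrite {}uu' => -[x [c [Xx ->]]] Axc.
  have [->|c0] := eqVneq c 0; first by rewrite scale0r addr0; exists x.
  case: nvw; apply: (csubZ_inv (csub_adj w' cX) c0).
  rewrite -[_ *: _](addrK x) addrC [_ + x]addrC addrC.
  by apply: csubB => //; [exact: csub_adj | exact: sub_adj].
have oL u : orth X u -> orth (f X) (L u).
  by move=> ou _ /fXL[x Xx <-]; rewrite lin_isometry_ip//; exact: ou.
have [c ec] : exists c, L v' = c *: a.
  apply: (adj_inj cfX) => //; first exact: oL.
  by rewrite -fa ev; apply: imageP; exact: adj_mem.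
have [d ed] : exists d, L w' = d *: b.
  apply: (adj_inj cfX) => //; first exact: oL.
  by rewrite -fb ew; apply: imageP; exact: adj_mem.
by exists c, d.
Qed.

Lemma line_map_ip T : line_map T -> forall v w, `|'[T v, T w]| = `|'[v, w]|.
Proof.
move=> hT v w; have [X gX [ov ow]] := exists_Ginf_orth v w bigT.
have cX := Ginf_csub gX.
have ha := hT v X gX ov; have hb := hT w X gX ow.
have [vw|nvw] := pselect (adj X w v); first exact: step_image_ip_dep vw.
have [wv|nwv] := pselect (adj X v w).
  by rewrite ip_normC [RHS]ip_normC; exact: step_image_ip_dep wv.
have v0 : '[v, v] != 0.
  rewrite ipxx_eq0; apply/eqP => v0; apply: nvw; rewrite v0.
  exact: csub0 (csub_adj _ cX).
have w0 : '[w, w] != 0.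
  rewrite ipxx_eq0; apply/eqP => w0; apply: nwv; rewrite w0.
  exact: csub0 (csub_adj _ cX).
move: (T v) (T w) ha hb => a b ha hb; have [aa _ _] := ha; have [bb _ _] := hb.
suff [v' [w' [L [c [d [[hL ec ed] [e1 e2]]]]]]] : exists v' w' (L : H -> H) c d,
    [/\ linear_isometry ip L, L v' = c *: a & L w' = d *: b] /\
    ('[v', v'] * '[w', w'] = '[v, v] * '[w, w] /\ `|'[v', w']| = `|'[v, w]|).
  (* The norm identities give [c * d] modulus 1; multiplying by the nonzero squared norms avoids
     solving for [c] and [d]. *)
  apply: sqrC_inj => //; rewrite -e2.
  apply: (mulfI v0); apply: (mulfI w0).
  rewrite mulrA [X in X * _ = _]mulrC -e1.
  rewrite -(lin_isometry_ip hL v' v') -(lin_isometry_ip hL w' w').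
  rewrite -(lin_isometry_ip hL v' w') ec ed !ipE aa bb !normrM !exprMn norm_conjC !normCK.
  ring.
have [L [hL [[eA eB]|[eA eB]]]] := hpair (Ginf_adj v gX) (Ginf_adj w gX).
  have [c [d [ec ed]]] := step_image_ip_iso gX ha hb ov ow nvw hL eA eB.
  by exists v, w, L, c, d.
have [c [d [ec ed]]] := step_image_ip_iso gX ha hb ow ov nwv hL eA eB.
by exists w, v, L, c, d; split=> //; split; [rewrite mulrC | exact: ip_normC].
Qed.

Lemma exists_line_isometry : exists L : H -> H,
  (linear_isometry ip L \/ conj_linear_isometry ip L) /\ line_map L.
Proof.
have [T hT] := line_map_exists.
have [x [_ x0 _]] := bigT [::].
have e1 : '[(hnorm ip x)^-1 *: x, (hnorm ip x)^-1 *: x] = 1.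
  have h0 : hnorm ip x != 0 by rewrite sqrtC_eq0 ipxx_eq0.
  have hr : (hnorm ip x)^* = hnorm ip x.
    by apply/CrealP/ger0_real; rewrite sqrtC_ge0; exact: ip_ge0.
  rewrite !ipE fmorphV /= hr -hnorm_sqr; by field.
have [L [hL LT]] := wigner (line_map_ip hT) e1.
exists L; split=> // v X gX oX; have hv := hT v X gX oX; have [c ec] := LT v.
(* [L v] is a multiple of [T v] of the same norm, so [L] inherits the line property from [T]. *)
apply: (step_image_scale hv ec); rewrite (wigner_norm (line_map_ip hT)).
by case: hL => -[_]; exact: norm_preservingE.
Qed.

(** * The orthogonal remainder *)

Section Decomposition.
Variable L : H -> H.
Hypothesis isoL : linear_isometry ip L \/ conj_linear_isometry ip L.

Lemma isoD x y : L (x + y) = L x + L y.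
Proof. by case: isoL => -[hL _]; [exact: lin_add | exact: conj_lin_add]. Qed.

Lemma isoN x : L (- x) = - L x.
Proof.
case: isoL => -[hL _].
  by rewrite -[in LHS]scaleN1r lin_scale// scaleN1r.
by rewrite -[in LHS]scaleN1r conj_lin_scale// rmorphN rmorph1 scaleN1r.
Qed.

Lemma iso_norm x : '[L x, L x] = '[x, x].
Proof. by case: isoL => -[_]; exact: norm_preservingE. Qed.

Lemma iso_orth x y : '[x, y] = 0 -> '[L x, L y] = 0.
Proof.
case: isoL => hL xy; first by rewrite lin_isometry_ip.
by rewrite (conj_lin_isometry_ip hL); exact: ip_orthC.
Qed.

Lemma cvg_cauchy u l : seq_cvg_to ip u l -> cauchy_seq ip u.
Proof.
move=> /seq_cvg_sqr ul e e0.
have [N hN] := ul _ (divr_gt0 (exprn_gt0 2 e0) (ltr0Sn _ 3)).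
exists N => m n /hN hm /hN hn; rewrite hnorm_ltE//.
have -> : u m - u n = (u m - l) - (u n - l) by rewrite opprB addrA subrK.
have := parallelogram (u m - l) (u n - l).
move/(canRL (addKr _)) => ->; rewrite addrC.
have h : 2 * ('[u m - l, u m - l] + '[u n - l, u n - l]) < 2 * (e ^+ 2 / 4 + e ^+ 2 / 4).
  by rewrite ltr_pM2l ?ltr0Sn// ltrD.
have -> : e ^+ 2 = 2 * (e ^+ 2 / 4 + e ^+ 2 / 4) by field.
by apply: le_lt_trans h; rewrite gerBl (ip_ge0 ipP).
Qed.

(** Distances are preserved, so the preimages of a convergent sequence are Cauchy and converge in
    [X]. *)
Lemma csub_image (X : set H) : closed_subspace ip X -> closed_subspace ip (L @` X).
Proof.
move=> cX; have [[X0 Xl] Xc] := cX; split; first split.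
- by exists 0 => //; case: isoL => -[hL _]; [exact: lin0 | exact: conj_lin0].
- move=> a _ _ [x Xx <-] [y Xy <-]; case: isoL => -[hL _].
    by rewrite -hL; apply: imageP; exact: Xl.
  by rewrite -{1}[a]conjCK -hL; apply: imageP; exact: Xl.
move=> u l uX ul.
have /choice[x hx] : forall n, exists x, X x /\ L x = u n.
  by move=> n; have [x Xx e] := uX n; exists x.
have hnL y : hnorm ip (L y) = hnorm ip y by rewrite /hnorm iso_norm.
have LB y z : L (y - z) = L y - L z by rewrite isoD isoN.
have [x0 xx0] : exists x0, seq_cvg_to ip x x0.
  apply: completeH => e /(cvg_cauchy ul)[N hN]; exists N => m n Nm Nn.
  by rewrite -hnL LB (hx m).2 (hx n).2; exact: hN.
exists x0; first by apply: (Xc x) => // n; exact: (hx n).1.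
apply: (cvg_unique (u := u)) => // e /xx0[N hN]; exists N => n /hN.
by rewrite -(hx n).2 -LB hnL.
Qed.

Hypothesis lineL : line_map L.

Lemma f_image X x : Ginf ip X -> X x -> f X (L x).
Proof.
move=> gX Xx; have gW := Ginf_cap x gX; set W := X `&` _ in gW.
have oW : orth W x by move=> w [_ /orth1E]; exact: ip_orthC.
have [_ _] := lineL gW oW; rewrite adj_capK//; last exact: Ginf_csub.
by move=> ->; exact: adj_mem (Ginf_csub (hf gW)).
Qed.

Lemma f_image_orth X x : Ginf ip X -> orth X x -> orth (f X) (L x).
Proof. by move=> gX oX; have [] := lineL gX oX. Qed.

Definition remainder X : set H := f X `&` orth (range L).

Lemma remainder_decomposes : decomposes ip f L remainder.
Proof.
move=> X gX; have cX := Ginf_csub gX; have cfX := Ginf_csub (hf gX).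
split; first exact: csubI.
split; first by move=> o x [_ oL]; apply: oL; exact: imageP.
apply/seteqP; split=> [y fy|_ [_ [o [[x Xx <-] [[fo _] ->]]]]]; last first.
  by apply: csubD => //; exact: f_image.
have [_ [x Xx <-] oy] := projection y (csub_image cX).
have fr : f X (y - L x) by apply: csubB => //; exact: f_image.
exists (L x), (y - L x); split; first exact: imageP.
split; last by rewrite addrC subrK.
split=> // _ [z _ <-]; have [z1 Xz1 oz] := projection z cX.
(* The vector [y - L x] is orthogonal to the image of [X] by projection; it lies in [f X], hence is
   also orthogonal to the image of the complement of [X]. *)
rewrite -(subrK z1 z) isoD ipDr [X in _ + X]oy ?addr0; last exact: imageP.
by apply: ip_orthC; apply: f_image_orth oz _ fr.
Qed.

(** Once [v] is replaced by its part orthogonal to [X], the image grows only by a line in the range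
    of [L], to which remainders are orthogonal. *)
Lemma remainder_adj X v : Ginf ip X -> remainder (adj X v) = remainder X.
Proof.
move=> gX; have cX := Ginf_csub gX; have gA := Ginf_adj v gX.
apply/seteqP; split; last first.
  by move=> o [fo oL]; split=> //; move: fo; apply: f_mono => //; exact: sub_adj.
have [x Xx op] := projection v cX.
rewrite (@adj_projE X v (v - x))//; last by rewrite opprB addrC subrK.
have [_ oq fq] := lineL gX op.
move=> o [fo oL]; split=> //; move: fo oL; rewrite fq => -[y [c [fy ->]]] oL.
suff -> : c *: L (v - x) = 0 by rewrite addr0.
have := oL _ (imageP L (I : setT (v - x))).
rewrite ipDl (ip_orthC (oq _ fy)) add0r ipZl => /eqP.
rewrite mulf_eq0 ipxx_eq0 => /orP[] /eqP ->; [exact: scale0r | exact: scaler0].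
Qed.

Lemma remainder_finspan X s : Ginf ip X ->
  Ginf ip (setsum X (finspan s)) /\ remainder (setsum X (finspan s)) = remainder X.
Proof.
move=> gX; elim: s => [|a s [gs es]]; first by rewrite finspan0 setsum0.
rewrite finspan_cons setsum_adj; split; first exact: Ginf_adj.
by rewrite remainder_adj.
Qed.

Lemma remainder_fin_codim X W : Ginf ip X -> closed_subspace ip W ->
  fin_codim X W -> remainder X = remainder W.
Proof.
move=> gX cW [s Xs]; suff gW : Ginf ip W.
  by rewrite Xs; have [] := remainder_finspan s gW.
have /choice[pr hpr] : forall v, exists x, W x /\ orth W (v - x).
  by move=> v; have [x] := projection v cW; exists x.
(* The added generators are made orthogonal to [W], so that a vector of [X] orthogonal to all of
   them already lies in [W]. This shows that [W] is infinite-dimensional. *)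
pose s' := [seq v - pr v | v <- s].
have Xs' : X = setsum W (finspan s').
  rewrite Xs; suff [] : setsum W (finspan s) = setsum W (finspan s') /\
    closed_subspace ip (setsum W (finspan s)) /\ W `<=` setsum W (finspan s) by [].
  rewrite {}/s'; elim: s {Xs} => [|a s [IH [cs Ws]]] /=.
    by rewrite finspan0 setsum0; do 2!split=> //.
  rewrite !finspan_cons !setsum_adj -IH; split.
    apply: adj_projE => //; rewrite opprB addrC subrK; apply: Ws; exact: (hpr a).1.
  by split; [exact: csub_adj | apply: subset_trans Ws _; exact: sub_adj].
have WX : W `<=` X.
  rewrite Xs => w Ww; exists w, 0; do 2?split=> //; last by rewrite addr0.
  by exists (fun=> 0); rewrite big1// => i _; rewrite scale0r.
have bW : big W.
  move=> t; have /GinfP[_ bX _] := gX; have [x [Xx x0 xo]] := bX (t ++ s').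
  exists x; split=> //; last by move=> y yt; apply: xo; rewrite mem_cat yt.
  move: Xx; rewrite Xs' => -[w [b [Ww [sb e]]]].
  have xb : '[x, b] = 0.
    by apply: orth_finspan sb => y ys; apply: xo; rewrite mem_cat ys orbT.
  have wb : '[w, b] = 0.
    apply: orth_finspan sb => _ /mapP[v _ ->]; apply: ip_orthC.
    exact: (hpr v).2.
  have b0 : b = 0 by apply: (ip_def ipP); rewrite -xb e ipDl wb add0r.
  by rewrite e b0 addr0.
exact: (Ginf_between cW bW (@subset_refl _ _) gX WX).
Qed.

Lemma remainder_component X Y : Ginf ip X -> Ginf ip Y -> same_component X Y ->
  remainder X = remainder Y.
Proof.
move=> gX gY [XY YX]; have cXY := csubI (Ginf_csub gX) (Ginf_csub gY).
by rewrite (remainder_fin_codim gX cXY XY) (remainder_fin_codim gY cXY YX).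
Qed.

Lemma remainder_mono X Y : Ginf ip X -> Ginf ip Y -> X `<=` Y ->
  remainder X `<=` remainder Y.
Proof. by move=> gX gY /(f_mono gX gY) XY x [/XY fx]. Qed.

End Decomposition.

(** * Uniqueness of the isometry up to a scalar *)

Lemma decomposes_multiple (L L' : H -> H) (O' : set H -> set H) :
  linear_isometry ip L \/ conj_linear_isometry ip L ->
  line_map L ->
  linear_isometry ip L' \/ conj_linear_isometry ip L' ->
  decomposes ip f L' O' ->
  exists c : R[i], L' = (fun x => c *: L x).
Proof.
move=> isoL lineL isoL' dec.
(* Both [L v] and [L' v] are orthogonal to [f X] and lie in [f (adj X v)], so they are
   proportional. *)
have /choice[c hc] : forall v, exists c, L' v = c *: L v.
  move=> v; have [X gX [ov _]] := exists_Ginf_orth v v bigT.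
  have [_ oq fq] := lineL v X gX ov.
  have [_ [oO fX]] := dec X gX; have [[[O0 _] _] [_ fA]] := dec _ (Ginf_adj v gX).
  apply: (adj_inj (Ginf_csub (hf gX))) => //.
    rewrite fX => _ [_ [o [[x Xx <-] [Oo ->]]]].
    rewrite ipDr (iso_orth isoL') ?add0r; last exact: ov.
    exact/ip_orthC/oO.
  rewrite -fq fA; exists (L' v), 0; split.
    by apply: imageP; exact: adj_mem (Ginf_csub gX).
  by rewrite addr0.
(* For orthogonal vectors, additivity at [v + w] and the inner product with [L v] force a common
   factor. *)
have const v w : v != 0 -> '[w, v] = 0 -> L' w = c v *: L w.
  move=> v0 wv; have Lwv := iso_orth isoL wv.
  have := hc (v + w); rewrite (isoD isoL') (isoD isoL) (hc v) (hc w) => e.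
  have k : c v = c (v + w).
    have := congr1 (fun x => '[x, L v]) e.
    rewrite /= !ipE Lwv !(mulr0, addr0) => /mulIf; apply.
    by rewrite iso_norm// ipxx_eq0.
  by move: e; rewrite -k scalerDr => /addrI.
have [v [_ v0 _]] := bigT [::]; exists (c v); apply/funext => w.
(* A nonzero [u] orthogonal to both [v] and [w] links their factors even when [v] and [w] are not
   orthogonal. *)
have [u [_ u0 hu]] := bigT [:: v; w].
have uv : '[u, v] = 0 by apply: hu; rewrite !inE eqxx.
have wu : '[w, u] = 0 by apply: ip_orthC; apply: hu; rewrite !inE eqxx orbT.
rewrite (const u w u0 wu); congr (_ *: _).
have Lu : L u != 0 by rewrite -ipxx_eq0 iso_norm// ipxx_eq0.
have := const v u v0 uv; rewrite (hc u) => /eqP; rewrite -subr_eq0 -scalerBl.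
by rewrite scaler_eq0 (negbTE Lu) orbF subr_eq0 => /eqP.
Qed.

End EquivalentPairs.

End InnerProduct.

Unset Implicit Arguments.

Theorem theorem1 (R : realType) (H : lmodType R[i]) (ip : H -> H -> R[i])
  (hH : hilbert_space ip) (hinf : inf_dim (@setT H))
  (f : set H -> set H)
  (hf : forall X, Ginf ip X -> Ginf ip (f X))
  (hpair : forall X Y, Ginf ip X -> Ginf ip Y ->
     equivalent_pairs ip X Y (f X) (f Y)) :
  exists L : H -> H,
    (linear_isometry ip L \/ conj_linear_isometry ip L) /\
    (forall L' : H -> H,
       (linear_isometry ip L' \/ conj_linear_isometry ip L') ->
       (exists O' : set H -> set H, decomposes ip f L' O') ->
       exists c : R[i], L' = (fun x => c *: L x)) /\
    exists O : set H -> set H,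
      decomposes ip f L O /\
      (forall X Y, Ginf ip X -> Ginf ip Y -> same_component X Y -> O X = O Y) /\
      (forall X Y, Ginf ip X -> Ginf ip Y -> Y `<=` X -> O Y `<=` O X).
Proof.
have [ipP complH] := hH.
have bigT : big ip (@setT H) by apply: inf_dim_big hinf.
have [L [isoL lineL]] := exists_line_isometry ipP complH hf hpair bigT.
exists L; split=> //; split.
  move=> L' isoL' [O' dec].
  exact: (decomposes_multiple ipP complH hf bigT isoL lineL isoL' dec).
exists (remainder ip f L); split; first exact: remainder_decomposes.
split=> X Y gX gY h; first exact: remainder_component h.
exact: remainder_mono h.
Qed.
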